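(* Let $\Omega\subsetneq\mathbb{R}^n$ be open with $R:=\sup_{x\in\Omega}d(x)<\infty$. For all $u\in C_c^\infty(\Omega)$ and all $s>n$, $$\int_\Omega\frac{|\nabla u|}{d^{s-1}}dx-(s-n)\int_\Omega\frac{|u|}{d^s}dx\ \ge\ \frac{1}{R^{s-n}}\int_\Omega\frac{|\nabla u|}{d^{n-1}}dx.$$
   Context: $d(x):=\operatorname{dist}(x,\mathbb{R}^n\setminus\Omega)$. *)

(* Defs.v *)
From HB Require Import structures.
From mathcomp Require Import all_boot all_order all_algebra.
From mathcomp Require Import all_classical all_reals all_analysis.
Set Implicit Arguments. Unset Strict Implicit. Unset Printing Implicit Defensive.
Import Order.TTheory GRing.Theory Num.Theory.
Import numFieldNormedType.Exports.
Local Open Scope classical_set_scope.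
Local Open Scope ring_scope.

Section Defs.
Variables (R : realType) (n : nat).

(* Euclidean norm on R^n (the library norm on 'rV_n is the max norm). *)
Definition enorm (v : 'rV[R]_n) : R := Num.sqrt (\sum_(i < n) v 0 i ^+ 2).

Definition dist_compl (Om : set 'rV[R]_n) (x : 'rV[R]_n) : R :=
  inf [set enorm (x - y) | y in ~` Om].

Definition partial (i : 'I_n) (f : 'rV[R]_n -> R) : 'rV[R]_n -> R :=
  fun x => 'D_(delta_mx 0 i) f x.

Definition smooth (f : 'rV[R]_n -> R) : Prop :=
  forall l : seq 'I_n, continuous (foldr partial f l) /\
    (forall (i : 'I_n) (x : 'rV[R]_n), derivable (foldr partial f l) x (delta_mx 0 i)).

Definition Cc_infty (Om : set 'rV[R]_n) (f : 'rV[R]_n -> R) : Prop :=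
  smooth f /\ compact (closure [set x | f x != 0]) /\
  closure [set x | f x != 0] `<=` Om.

Definition grad_norm (f : 'rV[R]_n -> R) (x : 'rV[R]_n) : R :=
  Num.sqrt (\sum_(i < n) (partial i f x) ^+ 2).

End Defs.

(* Lebesgue integral on R^n of a nonnegative extended-real function,
   defined as the iterated one-dimensional Lebesgue integral
   (Tonelli: equals the integral against n-dimensional Lebesgue measure). *)
Fixpoint integralRn (R : realType) (n : nat) : ('rV[R]_n -> \bar R) -> \bar R :=
  match n return ('rV[R]_n -> \bar R) -> \bar R with
  | 0 => fun f => f 0
  | m.+1 => fun f =>
      (\int[@lebesgue_measure R]_t
          integralRn (fun v : 'rV[R]_m => f (row_mx (\row_(j < 1) t) v)))%E
  end.

Definition integral_on (R : realType) (n : nat) (Om : set 'rV[R]_n)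
  (g : 'rV[R]_n -> R) : \bar R :=
  integralRn (fun x => if x \in Om then (g x)%:E else 0%E).

(* Main.v *)
Require Import Defs.
From HB Require Import structures.
From mathcomp Require Import all_boot all_order all_algebra.
From mathcomp Require Import all_classical all_reals all_analysis.
From mathcomp Require Import measurable_realfun.
From mathcomp Require Import ring lra.
Set Implicit Arguments. Unset Strict Implicit. Unset Printing Implicit Defensive.
Import Order.TTheory GRing.Theory Num.Theory.
Import numFieldNormedType.Exports.
Local Open Scope classical_set_scope.
Local Open Scope ring_scope.

(** Fix a finite set of points outside [Om] and let [p x] be the one nearest to
[x], [D x = |x - p x|] and [T_t x = p x + t (x - p x)] for [0 <= t <= 1]. Since
[p (T_t x) = p x], the map [T_t] sends each Voronoi cell into itself by a
dilation of ratio [t]; hence [D (T_t x) = t D x] and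
[int H(T_t x) dx <= t^-n int H] for every [H >= 0]. As [u (p x) = 0],
integrating along the segment from [p x] to [x] gives
[|u x| <= int_0^1 |grad u|(T_t x) D x dt]. Multiplying by [D x ^ -s], where
[D <= rho] on the support of [u], and integrating over [x],
[int |u| D^-s <= int |grad u| D^(1-s) (int_(D/rho)^1 t^(s-n-1) dt)
   = (s - n)^-1 int |grad u| (D^(1-s) - rho^(n-s) D^(1-n))].
By compactness of the support the finite set can be chosen with [d <= D <= k d]
there, for any [k > 1], so that [rho = k Rsup] works; then [k] tends to [1]. *)

(** * Measurability on ['rV_n] and the iterated integral *)

(* The sigma-algebra generated by the coordinates plays the role of the Borel
   sets of R^n: it makes the slices of [integralRn] measurable. *)
Definition coord_preimages (R : realType) (n : nat) : set (set 'rV[R]_n) :=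
  [set A | exists (i : 'I_n) (B : set (measurableTypeR R)),
     measurable B /\ A = (fun v : 'rV[R]_n => v 0 i) @^-1` B].

Notation mrV R n := (g_sigma_algebraType (@coord_preimages R n)).

Section measurable_rV.
Context {R : realType}.

Lemma measurable_coord n (i : 'I_n) :
  measurable_fun (setT : set (mrV R n))
    ((fun v : 'rV[R]_n => v 0 i) : mrV R n -> measurableTypeR R).
Proof.
by move=> _ B mB; rewrite setTI; apply: sub_sigma_algebra; exists i, B.
Qed.

Lemma measurable_to_rV d (T : measurableType d) n (f : T -> mrV R n) :
  (forall i, measurable_fun setT
     ((fun x => (f x : 'rV[R]_n) 0 i) : T -> measurableTypeR R)) ->
  measurable_fun setT f.
Proof.
move=> mf.
have := @measurability _ _ T (mrV R n) setT f (@coord_preimages R n) erefl; apply.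
move=> _ [_ [i [B [mB ->]] <-]].
by have := mf i measurableT B mB.
Qed.

Lemma measurable_row_cons d (T : measurableType d) n
    (f : T -> measurableTypeR R) (g : T -> mrV R n) :
  measurable_fun setT f -> measurable_fun setT g ->
  measurable_fun setT
    ((fun x => row_mx (\row_(j < 1) f x) (g x : 'rV[R]_n)) : T -> mrV R n.+1).
Proof.
move=> mf mg; apply: measurable_to_rV => i.
have [k ->|k ->] := @split_ordP 1 n i.
- apply: (eq_measurable_fun f) => // x _.
  by rewrite (@row_mxEl _ 1 1 n) mxE.
- apply: (eq_measurable_fun (fun x => (g x : 'rV[R]_n) 0 k)).
    by move=> x _; rewrite (@row_mxEr _ 1 1 n).
  exact: (measurableT_comp (measurable_coord k) mg).
Qed.

(* An open set is a countable union of half-open cubes with corners in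
   [k^-1 Z^n]. *)
Lemma measurable_open n (U : set 'rV[R]_n) : open U ->
  measurable (U : set (mrV R n)).
Proof.
move=> oU.
pose box (q : {ffun 'I_n -> int} * nat) : set (mrV R n) :=
  \bigcap_(i in [set: 'I_n]) [set v : 'rV[R]_n |
     (q.1 i)%:~R <= v 0 i * q.2.+1%:R < (q.1 i)%:~R + 1].
have mbox q : measurable (box q).
  apply: fin_bigcap_measurable => // i _.
  have mc : measurable_fun setT
      ((fun v : 'rV[R]_n => v 0 i * q.2.+1%:R) : mrV R n -> measurableTypeR R).
    by apply: measurable_funM => //; exact: measurable_coord.
  have := mc measurableT `[(q.1 i)%:~R, (q.1 i)%:~R + 1[%classic.
  rewrite setTI => /(_ (measurable_itv _)).
  by under [X in measurable X]eq_set do rewrite /= in_itv/=.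
have -> : U = \bigcup_q (if `[< box q `<=` U >] then box q else set0).
  apply/seteqP; split => [x Ux|x [q _]]; last first.
    by case: ifPn => // /asboolP; apply.
  have /nbhs_ballP[e /= e0 eU] := open_nbhs_nbhs (conj oU Ux).
  (* The library norm is the max norm, so the ball of radius [e] is itself a cube, and a cube of
     side [k.+1%:R^-1 < e] containing [x] lies inside it. *)
  pose k := Num.truncn e^-1.
  have ke : k.+1%:R^-1 < e.
    by rewrite invf_plt ?posrE// truncnS_gt.
  exists ([ffun i => Num.floor (x 0 i * k.+1%:R)], k) => //.
  set q := (_, _).
  have bx : box q x.
    by move=> i _ /=; rewrite ffunE floor_le -[1]/(1%:~R) -intrD floorD1_gt.
  case: asboolP => // -[] y /= yb; apply: eU; split => // i0 i; rewrite ord1 {i0}.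
  have /andP[y1 y2] := yb i I; have /andP[x1 x2] := bx i I.
  move: y1 y2 x1 x2; rewrite /=.
  have k0 : 0 < k.+1%:R :> R by rewrite ltr0n.
  rewrite /ball/= => y1 y2 x1 x2; apply: le_lt_trans ke.
  rewrite -[leLHS]mulr1 -[X in _ * X](mulfV (lt0r_neq0 k0)) mulrA.
  rewrite ler_pdivrMr// mulVf ?lt0r_neq0//.
  rewrite -[X in _ * X](ger0_norm (ltW k0)) -normrM mulrBl.
  rewrite ler_norml; lra.
apply: countable_bigcupT_measurable => // q.
by case: ifP => // _; exact: measurable0.
Qed.

(** Open intervals generate the sigma-algebra of the line and have open preimages, so
    [measurable_open] suffices. *)
Lemma continuous_measurable_rV n (f : 'rV[R]_n -> R) : continuous f ->
  measurable_fun (setT : set (mrV R n)) (f : mrV R n -> measurableTypeR R).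
Proof.
move=> /continuousP cf.
have := @measurability _ _ (mrV R n) (measurableTypeR R) setT f _ (@RGenOpens.measurableE R).
apply.
move=> _ [_ [a [b ->] <-]]; rewrite setTI.
by apply: measurable_open; apply: cf; exact: interval_open.
Qed.

End measurable_rV.

(** * Affine changes of variable on the line *)

Section affine.
Context {R : realType}.
Local Open Scope ereal_scope.
Local Notation mu := (@lebesgue_measure R).

(** The pushforward of Lebesgue measure under [x -> a + t x], multiplied by [t], gives each
    half-open interval its length, hence is Lebesgue measure by uniqueness. *)
Lemma ge0_integral_affine (f : measurableTypeR R -> \bar R) (a t : R) :
  (0 < t)%R -> measurable_fun setT f -> (forall x, 0 <= f x) ->
  \int[mu]_x f (a + t * x)%R = (t^-1)%:E * \int[mu]_x f x.
Proof.
move=> t0 mf f0.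
pose phi := (fun x => a + t * x)%R : measurableTypeR R -> measurableTypeR R.
have mphi : measurable_fun setT phi.
  by apply: measurable_funD => //; exact: measurable_funM.
(* The instance is given explicitly: [mphi] cannot be inferred from [phi]. *)
pose nu : {measure set (measurableTypeR R) -> \bar R} :=
  measure_function_pushforward__canonical__measure_function_Measure mu mphi.
have -> : \int[mu]_x f (a + t * x)%R = \int[nu]_x f x.
  by rewrite ge0_integral_pushforward.
have t0' : (0 <= t)%R by exact: ltW.
have muE A : measurable A -> mu A = mscale (NngNum t0') nu A.
  move=> mA; apply: lebesgue_measure_unique => //= _ [[u v]] _ <-.
  rewrite /mscale/= /pushforward/=.
  have -> : phi @^-1` `]u, v]%classic = `]((u - a) / t)%R, ((v - a) / t)%R]%classic.
    apply/seteqP; split => x /=; rewrite !in_itv/= /phi;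
      rewrite ltr_pdivrMr// ler_pdivlMr//; move=> /andP[? ?];
      by apply/andP; split; lra.
  rewrite !lebesgue_measure_itv/= !lte_fin ltr_pM2r ?invr_gt0// ltrD2r.
  case: ifPn => _; last by rewrite mule0.
  by rewrite -!EFinD -EFinM; congr EFin; field; exact: lt0r_neq0.
have -> : \int[mu]_x f x = \int[mscale (NngNum t0') nu]_x f x.
  by apply: eq_measure_integral => A mA _; exact: muE.
by rewrite ge0_integral_mscale//= muleA -EFinM mulVf ?lt0r_neq0// mul1e.
Qed.
End affine.

(** * Monotonicity, linearity, Tonelli and dilations for the iterated integral *)

Section integralRn_theory.
Context {R : realType}.
Local Open Scope ereal_scope.
Local Notation mu := (@lebesgue_measure R).

Lemma integralRn_ge0 n (f : 'rV[R]_n -> \bar R) : (forall x, 0 <= f x) ->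
  0 <= integralRn f.
Proof.
elim: n f => [|n ih] f f0 /=; first exact: f0.
by apply: integral_ge0 => t _; exact: ih.
Qed.

(** The parameter space [T] is arbitrary so that the induction can absorb the first coordinate into
    it; Tonelli then gives measurability once that coordinate is integrated out. *)
Lemma measurable_integralRn n d (T : measurableType d)
    (F : T * mrV R n -> \bar R) : measurable_fun setT F -> (forall x, 0 <= F x) ->
  measurable_fun setT (fun t => integralRn (fun v : 'rV[R]_n => F (t, v))).
Proof.
elim: n d T F => [|n ih] d T F mF F0 /=.
  apply: (measurableT_comp mF); exact: measurable_fun_pair.
pose G (z : (T * measurableTypeR R) * mrV R n) : \bar R :=
  F (z.1.1, row_mx (\row_(j < 1) z.1.2) z.2).
have mG : measurable_fun setT G.
  apply: (measurableT_comp mF); apply: measurable_fun_pair => /=.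
    by apply: measurableT_comp => //; exact: measurable_fst.
  apply: measurable_row_cons => //.
  by apply: (measurableT_comp measurable_snd); exact: measurable_fst.
have := ih _ _ G mG (fun x => F0 _).
move=> /(measurable_fun_fubini_tonelli_F (m2 := mu)); apply.
by move=> x; apply: integralRn_ge0 => v; exact: F0.
Qed.

Lemma measurable_slice d d' d'' (T : measurableType d) (U : measurableType d')
  (V : measurableType d'') (F : T * U -> V) (t : T) : measurable_fun setT F ->
  measurable_fun setT (fun v => F (t, v)).
Proof. by move=> mF; apply: (measurableT_comp mF); exact: measurable_fun_pair. Qed.

Lemma measurable_row_slices n (f : mrV R n.+1 -> \bar R) :
  measurable_fun setT f ->
  measurable_fun setT ((fun z => f (row_mx (\row_(j < 1) z.1) (z.2 : 'rV[R]_n)))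
    : measurableTypeR R * mrV R n -> \bar R).
Proof.
by move=> mf; apply: (measurableT_comp mf); exact: measurable_row_cons.
Qed.

Lemma measurable_row_slice n (f : mrV R n.+1 -> \bar R) (t : R) :
  measurable_fun setT f ->
  measurable_fun setT ((fun v => f (row_mx (\row_(j < 1) t) (v : 'rV[R]_n)))
    : mrV R n -> \bar R).
Proof.
move=> mf; exact: (measurable_slice t (measurable_row_slices mf)).
Qed.

Lemma measurable_integralRn_slice n (f : mrV R n.+1 -> \bar R) :
  measurable_fun setT f -> (forall x, 0 <= f x) ->
  measurable_fun setT ((fun t => integralRn
     (fun v : 'rV[R]_n => f (row_mx (\row_(j < 1) t) v))) : measurableTypeR R -> _).
Proof.
by move=> mf f0; exact: (measurable_integralRn (measurable_row_slices mf)).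
Qed.

Lemma le_integralRn n (f g : mrV R n -> \bar R) :
  measurable_fun setT f -> measurable_fun setT g ->
  (forall x, 0 <= f x) -> (forall x, f x <= g x) ->
  integralRn f <= integralRn g.
Proof.
elim: n f g => [|n ih] f g mf mg f0 fg /=; first exact: fg.
have g0 x : 0 <= g x by exact: le_trans (fg x).
apply: ge0_le_integral => //.
- by move=> t _; exact: integralRn_ge0.
- exact: measurable_integralRn_slice.
- exact: measurable_integralRn_slice.
- by move=> t _; apply: ih => //; exact: measurable_row_slice.
Qed.

Lemma integralRnD n (f g : mrV R n -> \bar R) :
  measurable_fun setT f -> measurable_fun setT g ->
  (forall x, 0 <= f x) -> (forall x, 0 <= g x) ->
  integralRn (fun x => f x + g x) = integralRn f + integralRn g.
Proof.
elim: n f g => [//|n ih] f g mf mg f0 g0 /=.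
transitivity (\int[mu]_t
    (integralRn (fun v : 'rV[R]_n => f (row_mx (\row_(j < 1) t) v)) +
     integralRn (fun v : 'rV[R]_n => g (row_mx (\row_(j < 1) t) v)))).
  apply: eq_integral => t _.
  by rewrite -ih//; exact: measurable_row_slice.
rewrite ge0_integralD//.
- by move=> t _; exact: integralRn_ge0.
- exact: measurable_integralRn_slice.
- by move=> t _; exact: integralRn_ge0.
- exact: measurable_integralRn_slice.
Qed.

Lemma integralRn0 n : integralRn (fun _ : 'rV[R]_n => 0) = 0.
Proof.
by elim: n => //= n ih; under eq_integral do rewrite ih; rewrite integral0.
Qed.

Lemma integralRn_sum n (I : Type) (r : seq I) (f : I -> mrV R n -> \bar R) :
  (forall i, measurable_fun setT (f i)) -> (forall i x, 0 <= f i x) ->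
  integralRn (fun x => \sum_(i <- r) f i x) = \sum_(i <- r) integralRn (f i).
Proof.
move=> mf f0; elim: r => [|i r ih].
  under [X in integralRn X]eq_fun do rewrite big_nil.
  by rewrite big_nil integralRn0.
under [X in integralRn X]eq_fun do rewrite big_cons.
rewrite integralRnD ?ih ?big_cons//; first exact: emeasurable_sum.
by move=> x; apply: sume_ge0.
Qed.

Lemma integralRnZl n (k : \bar R) (f : mrV R n -> \bar R) :
  measurable_fun setT f -> 0 <= k -> (forall x, 0 <= f x) ->
  integralRn (fun x => k * f x) = k * integralRn f.
Proof.
elim: n f => [//|n ih] f mf k0 f0 /=.
transitivity (\int[mu]_t
    (k * integralRn (fun v : 'rV[R]_n => f (row_mx (\row_(j < 1) t) v)))).
  by apply: eq_integral => t _; rewrite -ih//; exact: measurable_row_slice.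
rewrite ge0_integralZl//.
- exact: measurable_integralRn_slice.
- by move=> t _; exact: integralRn_ge0.
Qed.

(** Binary Tonelli exchanges [m] with the first coordinate; for each fixed value of that coordinate
    the induction hypothesis exchanges it with the others. *)
Lemma fubini_integralRn n d (T : measurableType d)
    (m : {sigma_finite_measure set T -> \bar R}) (F : T * mrV R n -> \bar R) :
  measurable_fun setT F -> (forall x, 0 <= F x) ->
  \int[m]_t integralRn (fun v : 'rV[R]_n => F (t, v)) =
  integralRn (fun v : 'rV[R]_n => \int[m]_t F (t, v)).
Proof.
elim: n d T m F => [//|n ih] d T m F mF F0 /=.
pose G (z : (T * measurableTypeR R) * mrV R n) : \bar R :=
  F (z.1.1, row_mx (\row_(j < 1) z.1.2) z.2).
have mG : measurable_fun setT G.
  apply: (measurableT_comp mF); apply: measurable_fun_pair => /=.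
    by apply: measurableT_comp => //; exact: measurable_fst.
  apply: measurable_row_cons => //.
  by apply: (measurableT_comp measurable_snd); exact: measurable_fst.
have -> := @fubini_tonelli _ _ T (measurableTypeR R) R m mu (fun z => integralRn
  (fun v : 'rV[R]_n => G (z, v))) (measurable_integralRn mG (fun _ => F0 _))
  (fun _ => integralRn_ge0 (fun _ => F0 _)).
apply: eq_integral => s _ /=.
rewrite -(ih _ _ m (fun z => F (z.1, row_mx (\row_(j < 1) s) (z.2 : 'rV[R]_n))))//.
apply: (measurableT_comp mF); apply: measurable_fun_pair => //=.
exact: measurable_row_cons.
Qed.

Lemma measurable_affine n (y : 'rV[R]_n) (t : R) :
  measurable_fun setT ((fun x => (y + t *: (x : 'rV[R]_n))%R) : mrV R n -> mrV R n).
Proof.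
apply: measurable_to_rV => i; under eq_fun do rewrite !mxE.
apply: measurable_funD => //; apply: measurable_funM => //.
exact: measurable_coord.
Qed.

(** Each coordinate contributes one factor [t^-1]: the first through [ge0_integral_affine], the
    others through the induction hypothesis on slices. *)
Lemma integralRn_affine n (f : mrV R n -> \bar R) (y : 'rV[R]_n) (t : R) :
  (0 < t)%R -> measurable_fun setT f -> (forall x, 0 <= f x) ->
  integralRn (fun x : 'rV[R]_n => f (y + t *: x)%R) =
  (t^-1 ^+ n)%:E * integralRn f.
Proof.
elim: n f y => [|n ih] f y t0 mf f0 /=.
  by rewrite expr0 mul1e; congr f; apply/rowP => -[].
pose y0 : R := y ord0 (lshift n (ord0 : 'I_1)).
pose y1 : 'rV[R]_n := (\row_j y ord0 (rshift 1 j))%R.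
pose g (s : R) (v : 'rV[R]_n) := f (row_mx (\row_(j < 1) s) v).
have E s : integralRn (fun v => f (y + t *: (row_mx (\row_(j < 1) s) v : 'rV_n.+1))%R) =
    (t^-1 ^+ n)%:E * integralRn (g (y0 + t * s)%R).
  rewrite -(ih (g (y0 + t * s)%R : mrV R n -> _) y1)//; last 2 first.
  - exact: measurable_row_slice.
  - by move=> v; exact: f0.
  congr integralRn; apply/funext => v; rewrite /g; congr f.
  apply/rowP => i; have [k ->|k ->] := @split_ordP 1 n i.
    by rewrite (@row_mxEl _ 1 1 n) 3!mxE (@row_mxEl _ 1 1 n) mxE ord1.
  by rewrite (@row_mxEr _ 1 1 n) 2!mxE (@row_mxEr _ 1 1 n) !mxE.
under eq_integral do rewrite E.
rewrite ge0_integralZl//; last 3 first.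
- have h : measurable_fun setT
      ((fun s => y0 + t * s)%R : measurableTypeR R -> measurableTypeR R).
    by apply: measurable_funD => //; exact: measurable_funM.
  exact: (measurableT_comp (measurable_integralRn_slice mf f0) h).
- by move=> s _; apply: integralRn_ge0 => v; exact: f0.
- by rewrite lee_fin exprn_ge0// invr_ge0 ltW.
rewrite (ge0_integral_affine (f := fun s => integralRn (g s)))//; last 2 first.
- exact: measurable_integralRn_slice.
- by move=> s; apply: integralRn_ge0 => v; exact: f0.
by rewrite muleA -EFinM -exprSr.
Qed.

(** The slice integral is a fixed finite number when the first coordinate lies in [[- M, M]] and
    zero otherwise. *)
Lemma integralRn_box_lty n (M : R) : (0 <= M)%R ->
  integralRn (fun x : 'rV[R]_n =>
    if `[< forall i, `|x 0 i| <= M >]%R then 1 else 0) < +oo.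
Proof.
move=> M0; elim: n => [|n ih] /=.
  by case: asboolP => _; rewrite ltry.
set I := integralRn _ in ih.
have -> : (fun t : R => integralRn (fun v : 'rV[R]_n =>
     if `[< forall i, (`|row_mx (\row_(j < 1) t) v 0%R i| <= M)%R >] then 1 else 0%R))
   = (fun t => I * (\1_(`[- M, M]%classic) t)%:E).
  apply/funext => t; rewrite indicE mem_setE in_itv/= -ler_norml.
  case: (boolP (`|t| <= M)%R) => tM.
    rewrite mule1; congr integralRn; apply/funext => v; congr (if _ then _ else _).
    apply/asboolP/asboolP => H i.
      by have := H (rshift 1 i); rewrite (@row_mxEr _ 1 1 n).
    have [k ->|k ->] := @split_ordP 1 n i.
      by rewrite (@row_mxEl _ 1 1 n) mxE.
    by rewrite (@row_mxEr _ 1 1 n).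
  rewrite mule0 -[RHS](integralRn0 n); congr integralRn; apply/funext => v.
  case: asboolP => // /(_ (lshift n (ord0 : 'I_1))).
  by rewrite (@row_mxEl _ 1 1 n) mxE (negbTE tM).
have I0 : 0 <= I by apply: integralRn_ge0 => x; case: ifP.
rewrite ge0_integralZl//; last first.
  by apply/measurable_EFinP; apply: measurable_indic; exact: measurable_itv.
rewrite integral_indic//= setIT lebesgue_measure_itv/=.
by rewrite lte_mul_pinfty ?ge0_fin_numE//; case: ifP => _; rewrite ?ltry.
Qed.

End integralRn_theory.

(** * Nearest points and contraction towards them *)

Section enorm_theory.
Context {R : realType}.

(** The sum of the squares of [B * a i - C * b i] equals [B * (A * B - C ^+ 2)], which is therefore
    nonnegative; if [B = 0] then every [b i] vanishes. *)
Lemma cauchy_schwarz_sum n (a b : 'I_n -> R) :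
  \sum_i a i * b i <= Num.sqrt (\sum_i a i ^+ 2) * Num.sqrt (\sum_i b i ^+ 2).
Proof.
set A := \sum_i a i ^+ 2; set B := \sum_i b i ^+ 2; set C := \sum_i a i * b i.
have A0 : 0 <= A by apply: sumr_ge0 => i _; exact: sqr_ge0.
have B0 : 0 <= B by apply: sumr_ge0 => i _; exact: sqr_ge0.
have [CB|CB] := leP C 0; first by rewrite (le_trans CB)// mulr_ge0.
rewrite -sqrtrM// -[leLHS](ger0_norm (ltW CB)) -sqrtr_sqr ler_wsqrtr//.
have key : 0 <= B * (A * B - C ^+ 2).
  have -> : B * (A * B - C ^+ 2) = \sum_i (B * a i - C * b i) ^+ 2.
    transitivity (\sum_i (B ^+ 2 * a i ^+ 2 + (- 2 * B * C) * (a i * b i) +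
        C ^+ 2 * b i ^+ 2)); last by apply: eq_bigr => i _; ring.
    rewrite !big_split/= -!mulr_sumr -/A -/B -/C; ring.
  by apply: sumr_ge0 => i _; exact: sqr_ge0.
have [B0'|B0'] := eqVneq B 0.
  have b0 i : b i = 0.
    have /psumr_eq0P : \sum_i b i ^+ 2 = 0 by [].
    move=> /(_ (fun i _ => sqr_ge0 (b i)))/(_ i isT)/eqP.
    by rewrite sqrf_eq0 => /eqP.
  by move: CB; rewrite /C big1 ?ltxx// => i _; rewrite b0 mulr0.
move: key; rewrite pmulr_rge0 ?lt_def ?B0'//.
by rewrite subr_ge0.
Qed.

Lemma enorm_ge0 n (x : 'rV[R]_n) : 0 <= enorm x.
Proof. exact: sqrtr_ge0. Qed.

Lemma enorm_sqr n (x : 'rV[R]_n) : enorm x ^+ 2 = \sum_i x 0 i ^+ 2.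
Proof. by rewrite sqr_sqrtr//; apply: sumr_ge0 => i _; exact: sqr_ge0. Qed.

Lemma enormD n (x y : 'rV[R]_n) : enorm (x + y) <= enorm x + enorm y.
Proof.
rewrite -(@ler_pXn2r _ 2)// ?nnegrE ?addr_ge0 ?enorm_ge0//.
rewrite sqrrD !enorm_sqr.
have -> : \sum_i (x + y) 0 i ^+ 2 = \sum_i x 0 i ^+ 2 +
   (\sum_i x 0 i * y 0 i) *+ 2 + \sum_i y 0 i ^+ 2.
  rewrite -sumrMnl -!big_split/=.
  by apply: eq_bigr => i _; rewrite mxE sqrrD.
by rewrite lerD2r lerD2l lerMn2r/= cauchy_schwarz_sum.
Qed.

Lemma enormZ n (k : R) (x : 'rV[R]_n) : enorm (k *: x) = `|k| * enorm x.
Proof.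
rewrite /enorm -sqrtr_sqr -sqrtrM ?sqr_ge0//; congr Num.sqrt.
by rewrite mulr_sumr; apply: eq_bigr => i _; rewrite mxE exprMn.
Qed.

Lemma enormN n (x : 'rV[R]_n) : enorm (- x) = enorm x.
Proof. by rewrite -scaleN1r enormZ normrN1 mul1r. Qed.

Lemma enormB n (x y : 'rV[R]_n) : enorm (x - y) = enorm (y - x).
Proof. by rewrite -opprB enormN. Qed.

Lemma enorm0 n : enorm (0 : 'rV[R]_n) = 0.
Proof. by rewrite -(scale0r 0) enormZ normr0 mul0r. Qed.

Lemma coord_le_enorm n (x : 'rV[R]_n) i : `|x 0 i| <= enorm x.
Proof.
rewrite -sqrtr_sqr ler_wsqrtr// (bigD1 i)//= lerDl.
by apply: sumr_ge0 => j _; exact: sqr_ge0.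
Qed.

Lemma enorm_eq0 n (x : 'rV[R]_n) : (enorm x == 0) = (x == 0).
Proof.
apply/eqP/eqP => [x0|->]; last exact: enorm0.
apply/rowP => i; rewrite mxE; apply/eqP; rewrite -normr_eq0 eq_le normr_ge0.
by rewrite -x0 coord_le_enorm.
Qed.

Lemma continuous_sqrt_sum_sqr (T : topologicalType) n (f : 'I_n -> T -> R) :
  (forall i, continuous (f i)) ->
  continuous (fun x => Num.sqrt (\sum_i f i x ^+ 2)).
Proof.
move=> cf.
have cs : continuous (fun x => \sum_i f i x ^+ 2).
  have ac : continuous (fun z : R * R => z.1 + z.2) by exact: add_continuous.
  have := @continuous_big _ 'I_n _ 0 xpredT ac T (index_enum _) (fun i x => f i x ^+ 2).
  apply=> i _ x; apply: (@continuous_comp _ _ _ (f i) (fun y => y ^+ 2)).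
    exact: cf.
  exact: exprn_continuous.
by move=> x; apply: continuous_comp; [exact: cs|exact: sqrt_continuous].
Qed.

Lemma continuous_enorm n : continuous (@enorm R n).
Proof.
by apply: continuous_sqrt_sum_sqr => i; exact: coord_continuous.
Qed.

End enorm_theory.

Section measurable_vector.
Context {R : realType} {n : nat} {d : measure_display} {T : measurableType d}.
Implicit Types f g : T -> mrV R n.

Lemma measurable_funD_rV f g : measurable_fun setT f -> measurable_fun setT g ->
  measurable_fun setT ((fun x => (f x : 'rV[R]_n) + g x) : T -> mrV R n).
Proof.
move=> mf mg; apply: measurable_to_rV => i; under eq_fun do rewrite mxE.
by apply: measurable_funD; exact: (measurableT_comp (measurable_coord i)).
Qed.

Lemma measurable_funZ_rV (k : T -> R) f : measurable_fun setT k ->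
  measurable_fun setT f ->
  measurable_fun setT ((fun x => k x *: (f x : 'rV[R]_n)) : T -> mrV R n).
Proof.
move=> mk mf; apply: measurable_to_rV => i; under eq_fun do rewrite mxE.
by apply: measurable_funM => //; exact: (measurableT_comp (measurable_coord i)).
Qed.

Lemma measurable_funB_rV f g : measurable_fun setT f -> measurable_fun setT g ->
  measurable_fun setT ((fun x => (f x : 'rV[R]_n) - g x) : T -> mrV R n).
Proof.
move=> mf mg; under eq_fun do rewrite -scaleN1r.
by apply: measurable_funD_rV => //; exact: measurable_funZ_rV.
Qed.

Lemma measurable_enorm f : measurable_fun setT f ->
  measurable_fun setT (fun x => enorm (f x : 'rV[R]_n)).
Proof.
by move=> mf; exact: (measurableT_comp (continuous_measurable_rV (@continuous_enorm R n))).
Qed.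

End measurable_vector.

(** * Voronoi cells of a finite set *)

Section nearest.
Context {R : realType} {n : nat}.
Implicit Types (x y q : 'rV[R]_n) (s : seq 'rV[R]_n).

(** The point [q] keeps the set nonempty. Ties go to the earliest entry of the list, so the Voronoi
    cells are disjoint, boundaries included. *)
Fixpoint nearest q s x : 'rV[R]_n :=
  if s is y :: s' then
    if enorm (x - y) <= enorm (x - nearest q s' x) then y else nearest q s' x
  else q.

Lemma nearest_in q s x : nearest q s x \in q :: s.
Proof.
elim: s => [|y s ih] /=; first exact: mem_head.
case: ifP => _; rewrite !inE ?eqxx ?orbT//.
by move: ih; rewrite inE => /orP[->//|->]; rewrite !orbT.
Qed.

Lemma nearest_min q s x y : y \in q :: s ->
  enorm (x - nearest q s x) <= enorm (x - y).
Proof.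
elim: s => [|z s ih] /=; first by rewrite inE => /eqP ->.
rewrite !inE orbCA; case: ifPn => [le|]; last rewrite -ltNge => /ltW le.
  move=> /orP[/eqP->//|ys]; apply: le_trans le _; apply: ih.
  by rewrite inE.
by move=> /orP[/eqP->//|ys]; apply: ih; rewrite inE.
Qed.

(** This is the map [T_t] of the overview. *)
Definition pull q s (t : R) x := nearest q s x + t *: (x - nearest q s x).

(* Moving [x] towards [p] by the factor [t] shortens [|x - p|] by exactly [(1-t)|x-p|]
   and [|x - y|] by at most that much. *)
Lemma enorm_segment_le (t : R) x p y : 0 <= t <= 1 ->
  enorm (x - y) - enorm (x - p) <=
  enorm (p + t *: (x - p) - y) - enorm (p + t *: (x - p) - p).
Proof.
move=> /andP[t0 t1]; rewrite [p + _ - p]addrAC subrr add0r enormZ ger0_norm//.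
have : enorm (x - y) <= enorm (p + t *: (x - p) - y) + (1 - t) * enorm (x - p).
  rewrite -[X in _ * enorm X]opprK -[1 - t]ger0_norm ?subr_ge0// -enormZ.
  apply: le_trans (enormD _ _).
  rewrite le_eqVlt; apply/orP; left; apply/eqP; congr enorm.
  by apply/rowP => i; rewrite !mxE; ring.
lra.
Qed.

(** By [enorm_segment_le], moving towards the selected point never reduces its advantage over a
    competitor. Strict and weak inequalities both persist, so every comparison in the list keeps its
    outcome, ties included. *)
Lemma nearest_pull q s (t : R) x : 0 <= t <= 1 ->
  nearest q s (pull q s t x) = nearest q s x.
Proof.
move=> t01; rewrite /pull; elim: s => [//|y s ih] /=.
have [le|lt] := leP (enorm (x - y)) (enorm (x - nearest q s x)).
  (* The competitor is the tail point nearest to the moved point, which may differ from the one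
     nearest to [x]; [nearest_min] at [x] bridges the two. *)
  have := @enorm_segment_le t x y (nearest q s (y + t *: (x - y))) t01.
  set z := y + _; move=> H; rewrite ifT//.
  by have := nearest_min x (nearest_in q s z); lra.
rewrite ih ifF//; apply/negbTE; rewrite -ltNge.
by have := @enorm_segment_le t x (nearest q s x) y t01; lra.
Qed.

Lemma pull_sub_nearest q s (t : R) x : 0 <= t <= 1 ->
  pull q s t x - nearest q s (pull q s t x) = t *: (x - nearest q s x).
Proof. by move=> t01; rewrite nearest_pull// /pull addrAC subrr add0r. Qed.

Lemma measurable_nearest q s :
  measurable_fun setT (nearest q s : mrV R n -> mrV R n).
Proof.
elim: s => [|y s ih] /=; first exact: measurable_cst.
apply: measurable_fun_ifT => //.
apply: measurable_fun_ler; apply: measurable_enorm; apply: measurable_funB_rV => //.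
Qed.

Lemma measurable_pull q s :
  measurable_fun setT
    ((fun z => pull q s z.1 z.2) : measurableTypeR R * mrV R n -> mrV R n).
Proof.
have mp : measurable_fun setT
    ((fun z => nearest q s z.2) : measurableTypeR R * mrV R n -> mrV R n).
  exact: (measurableT_comp (measurable_nearest q s)).
apply: measurable_funD_rV => //; apply: measurable_funZ_rV => //.
exact: measurable_funB_rV.
Qed.

Local Open Scope ereal_scope.

Let cell q s y (H : 'rV[R]_n -> \bar R) x :=
  if nearest q s x == y then H x else 0.

Let measurable_cell q s y (H : mrV R n -> \bar R) : measurable_fun setT H ->
  measurable_fun setT (cell q s y H : mrV R n -> _).
Proof.
move=> mH; apply: measurable_fun_ifT => //.
(* Equality of vectors becomes the vanishing of a measurable real function. *)
under eq_fun do rewrite -subr_eq0 -enorm_eq0.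
apply: measurable_fun_eqr => //; apply: measurable_enorm.
by apply: measurable_funB_rV => //; exact: measurable_nearest.
Qed.

(** Exactly one cell contains [x]; [undup] keeps a repeated point from counting its cell twice. *)
Let sum_cell q s (H : 'rV[R]_n -> \bar R) x :
  \sum_(y <- undup (q :: s)) cell q s y H x = H x.
Proof.
rewrite (bigD1_seq (nearest q s x)) ?undup_uniq ?mem_undup ?nearest_in//=.
rewrite big1 ?adde0 /cell ?eqxx// => y /negbTE.
by rewrite eq_sym => ->.
Qed.

(* [pull t] maps each Voronoi cell into itself by a dilation of ratio [t]. *)
Lemma integralRn_pull q s (t : R) (H : mrV R n -> \bar R) : (0 < t <= 1)%R ->
  measurable_fun setT H -> (forall x, 0 <= H x) ->
  integralRn (fun x => H (pull q s t x)) <= (t^-1 ^+ n)%:E * integralRn H.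
Proof.
move=> /andP[t0 t1] mH H0.
have t01 : (0 <= t <= 1)%R by rewrite ltW.
have mc y := measurable_cell q s y mH.
have c0 y x : 0 <= cell q s y H x by rewrite /cell; case: ifP.
have -> : integralRn H = \sum_(y <- undup (q :: s)) integralRn (cell q s y H).
  rewrite -integralRn_sum//; congr integralRn.
  by apply/funext => x; rewrite sum_cell.
rewrite ge0_sume_distrr; last by move=> y _; exact: integralRn_ge0.
have E y : (t^-1 ^+ n)%:E * integralRn (cell q s y H) =
    integralRn (fun x => cell q s y H ((y - t *: y) + t *: x)%R).
  by rewrite integralRn_affine.
under eq_bigr do rewrite E.
rewrite -integralRn_sum//; last first.
  move=> y; exact: (measurableT_comp (mc y) (measurable_affine _ _)).
have mp : measurable_fun setT (pull q s t : mrV R n -> mrV R n).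
  have := measurable_slice (t : measurableTypeR R) (measurable_pull q s). exact.
apply: le_integralRn => //.
- exact: (measurableT_comp mH mp).
- apply: emeasurable_sum => y.
  exact: (measurableT_comp (mc y) (measurable_affine _ _)).
(* The terms agree for the cell of [x]. For any other [y] the left term is zero, while the dilation
   about [y] may carry [x] into the cell of [y]: hence an inequality. *)
move=> x; rewrite -(sum_cell q s H (pull q s t x)).
apply: lee_sum => y _; rewrite /cell nearest_pull//.
case: ifPn => [/eqP xy|_]; last by case: ifP.
have -> : ((y - t *: y) + t *: x)%R = pull q s t x.
  by rewrite /pull xy scalerBr addrAC addrA.
by rewrite nearest_pull// xy eqxx.
Qed.

End nearest.

(** * Differentiation along lines *)

Section directional_derivatives.
Context {R : realType} {n : nat}.
Implicit Types (f fa fb : 'rV[R]_n -> R) (a b x y v : 'rV[R]_n).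

(** Both difference quotients are the same function of [h]; this reduces directional derivatives to
    calculus in one variable. *)
Lemma is_derive_lineP f (df : R) y b (s : R) :
  is_derive s 1 (fun r : R => f (y + r *: b)) df <->
  is_derive (y + s *: b) b f df.
Proof.
have E : (fun h : R => h^-1 *: (((fun r : R => f (y + r *: b)) \o shift s) (h *: 1) -
      f (y + s *: b))) =
  (fun h : R => h^-1 *: ((f \o shift (y + s *: b)) (h *: b) - f (y + s *: b))).
  apply/funext => h; rewrite /= /shift/=; congr (_ *: (f _ - _)).
  by rewrite scalerDl [h%:A]mulr1 addrCA.
split=> -[fd fE].
  by split; [rewrite /derivable -E; exact: fd|rewrite -fE /derive -E].
by split; [rewrite /derivable E; exact: fd|rewrite -fE /derive E].
Qed.

Lemma mean_value_line f fb y b (h : R) :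
  (forall x, is_derive x b f (fb x)) ->
  exists2 c : R, `|c| <= `|h| & f (y + h *: b) - f y = fb (y + c *: b) * h.
Proof.
move=> fD; set g := fun r : R => f (y + r *: b).
have gD (r : R) : is_derive r (1 : R) g (fb (y + r *: b)).
  exact/is_derive_lineP.
have gc : continuous g.
  by move=> r; apply: differentiable_continuous; apply/derivable1_diffP; have [] := gD r.
have g0 : g 0 = f y by rewrite /g scale0r addr0.
have gD' (I : interval R) r : r \in I -> is_derive r 1 g (fb (y + r *: b)).
  by move=> _; exact: gD.
rewrite -g0 -/(g h); have [h0|/ltW h0] := leP 0 h.
  have [c /itvP cI ->] := MVT_segment h0 (gD' _) (continuous_subspaceT gc).
  by exists c; [rewrite !ger0_norm ?cI|rewrite subr0].
have [c /itvP cI gE] := MVT_segment h0 (gD' _) (continuous_subspaceT gc).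
exists c; last by rewrite -opprB gE sub0r mulrN opprK.
by rewrite !ler0_norm ?cI// lerN2 cI.
Qed.

(** The increment along [h (a + b)] splits into one along [h a] from [x] and one along [h b] from
    [x + h a]. The mean value theorem writes the second as [h] times [fb] at a point tending to [x],
    where [fb] is continuous. *)
Lemma is_derive_add_direction f fa fb a b :
  (forall x, is_derive x a f (fa x)) -> (forall x, is_derive x b f (fb x)) ->
  continuous fb -> forall x, is_derive x (a + b) f (fa x + fb x).
Proof.
move=> fA fB cb x.
have /choice[c cE] (h : R) : exists c : R, `|c| <= `|h| /\
    f ((x + h *: a) + h *: b) - f (x + h *: a) = fb ((x + h *: a) + c *: b) * h.
  by have [c c1 c2] := mean_value_line (x + h *: a) h fB; exists c.
have c0 : c h @[h --> (0 : R)^'] --> (0 : R).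
  apply/cvgr0Pnorm_lt => e e0; near=> h.
  have [ch _] := cE h; apply: le_lt_trans ch _.
  by near: h; exact: dnbhs0_lt.
have lim_b : fb ((x + h *: a) + c h *: b) @[h --> (0 : R)^'] --> fb x.
  have p : (x + h *: a) + c h *: b @[h --> (0 : R)^'] --> x.
    have {2}-> : x = (x + 0 *: a) + 0 *: b by rewrite !scale0r !addr0.
    apply: cvgD; last exact: cvgZr_tmp.
    apply: cvgD; first exact: cvg_cst.
    by apply: cvgZr_tmp; exact: nbhs_dnbhs.
  exact: (cvg_comp _ _ p (cb x)).
have [fAd fAE] := fA x.
have lim : h^-1 *: ((f \o shift x) (h *: (a + b)) - f x) @[h --> (0 : R)^'] -->
    fa x + fb x.
  have -> : (fun h : R => h^-1 *: ((f \o shift x) (h *: (a + b)) - f x)) =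
      (fun h : R => h^-1 *: ((f \o shift x) (h *: a) - f x) +
         h^-1 * (fb ((x + h *: a) + c h *: b) * h)).
    apply/funext => h; have [_ <-] := cE h; rewrite /= /shift/=.
    rewrite [X in X = _]/GRing.scale [X in _ = X + _]/GRing.scale/= -mulrDr.
    rewrite scalerDr [h *: a + x]addrC [_ + x]addrC [x + (_ + _)]addrA.
    by congr (_ * _); ring.
  apply: cvgD; first by rewrite -fAE; exact: fAd.
  apply: cvg_trans lim_b; apply: near_eq_cvg; near=> h.
  have h0 : h != 0 by near: h; exact: nbhs_dnbhs_neq.
  by rewrite [RHS]mulrC -mulrA mulfV ?mulr1.
split; first by apply/cvg_ex; exists (fa x + fb x).
exact: cvg_lim.
Unshelve. all: by end_near. Qed.

Lemma is_derive_scale_direction f (df : R) a x (k : R) :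
  is_derive x a f df -> is_derive x (k *: a) f (k * df).
Proof.
move=> fD.
suff : is_derive (0 : R) 1 (fun r : R => f (x + r *: (k *: a))) (k * df).
  by move=> /is_derive_lineP; rewrite scale0r addr0.
have gD : is_derive (k * 0) 1 (fun r : R => f (x + r *: a)) df.
  by apply/is_derive_lineP; rewrite mulr0 scale0r addr0.
have -> : (fun r : R => f (x + r *: (k *: a))) =
    (fun r : R => f (x + r *: a)) \o (fun r => k * r).
  by apply/funext => r /=; rewrite scalerA mulrC.
have kD : is_derive (0 : R) 1 (fun r : R => k * r) k.
  by apply: is_derive_eq; rewrite [LHS]mulr1.
by have := @is_derive1_comp _ _ _ 0 _ _ gD kD; rewrite mulrC.
Qed.

Lemma is_derive_direction f : (forall (i : 'I_n) x, derivable f x (delta_mx 0 i)) ->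
  (forall i : 'I_n, continuous (partial i f)) ->
  forall v x, is_derive x v f (\sum_i v 0 i * partial i f x).
Proof.
move=> df cf v x.
(* Continuity is carried along because adding a direction requires the derivative in that direction
   to be continuous. *)
pose P v (g : 'rV[R]_n -> R) := (forall x, is_derive x v f (g x)) /\ continuous g.
suff [] : P v (fun x => \sum_i v 0 i * partial i f x) by [].
have {1}-> : v = \sum_i v 0 i *: delta_mx 0 i :> 'rV[R]_n.
  exact: row_sum_delta.
have -> : (fun x => \sum_i v 0 i * partial i f x) =
    \sum_i (fun x => v 0 i * partial i f x).
  by apply/funext => z; rewrite fct_sumE.
apply: (big_ind2 P).
- split=> [z|]; last exact: cst_continuous.
  suff : is_derive (0 : R) 1 (fun r : R => f (z + r *: 0)) 0.
    by move=> /is_derive_lineP; rewrite scaler0 addr0.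
  by under eq_fun do rewrite scaler0 addr0; exact: is_derive_cst.
- move=> v1 g1 v2 g2 [D1 c1] [D2 c2]; split=> [z|z].
    exact: is_derive_add_direction.
  by apply: continuousD; [exact: c1|exact: c2].
- move=> i _; split=> [z|z].
    by apply: is_derive_scale_direction; exact/derivableP.
  by apply: continuousM; [exact: cst_continuous|exact: cf].
Qed.

Lemma sum_partial_le_grad_norm f x v :
  `|\sum_i v 0 i * partial i f x| <= grad_norm f x * enorm v.
Proof.
rewrite mulrC ler_norml; apply/andP; split; last exact: cauchy_schwarz_sum.
rewrite -(enormN v) lerNl -sumrN.
rewrite (eq_bigr (fun i => (- v) 0 i * partial i f x)).
  exact: cauchy_schwarz_sum.
by move=> i _; rewrite mxE mulNr.
Qed.

Lemma continuous_grad_norm f : (forall i : 'I_n, continuous (partial i f)) ->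
  continuous (grad_norm f).
Proof. exact: continuous_sqrt_sum_sqr. Qed.

(** The fundamental theorem of calculus along the segment expresses the increment as an integral of
    directional derivatives, which Cauchy-Schwarz bounds. *)
Lemma increment_le_integral_grad_norm f y v :
  (forall (i : 'I_n) x, derivable f x (delta_mx 0 i)) ->
  (forall i : 'I_n, continuous (partial i f)) ->
  (`|f (y + v) - f y|%:E <= \int[lebesgue_measure]_(t in `[0%R, 1%R])
     (grad_norm f (y + t *: v) * enorm v)%:E)%E.
Proof.
move=> df cf.
pose g (t : R) := f (y + t *: v).
pose g' (t : R) := \sum_i v 0 i * partial i f (y + t *: v).
have cline : continuous (fun t : R => y + t *: v).
  move=> t; apply: cvgD; first exact: cvg_cst.
  by apply: cvgZr_tmp; exact: cvg_id.
have gD (t : R) : is_derive t (1 : R) g (g' t).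
  by apply/is_derive_lineP; exact: is_derive_direction.
have cg : continuous g.
  by move=> t; apply: differentiable_continuous; apply/derivable1_diffP; have [] := gD t.
have cg' : continuous g'.
  have ac : continuous (fun z : R * R => z.1 + z.2) by exact: add_continuous.
  apply: (@continuous_big _ 'I_n _ 0 xpredT ac R (index_enum _)
    (fun i t => v 0 i * partial i f (y + t *: v))) => i _ t.
  apply: cvgM; first exact: cvg_cst.
  exact: (cvg_comp _ _ (cline t) (cf i _)).
have cG : continuous (fun t : R => grad_norm f (y + t *: v) * enorm v).
  move=> t; apply: cvgM; last exact: cvg_cst.
  exact: (cvg_comp _ _ (cline t) (@continuous_grad_norm f cf (y + t *: v))).
have mc (h : R -> R) : continuous h ->
    measurable_fun (`[0%R, 1%R]%classic : set (measurableTypeR R))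
      (EFin \o h : measurableTypeR R -> \bar R).
  by move=> ch; apply/measurable_EFinP; apply: measurable_funTS;
     exact: continuous_measurable_fun.
have -> : f (y + v) - f y = g 1 - g 0.
  by rewrite /g scale1r scale0r addr0.
have FTC : (\int[lebesgue_measure]_(t in `[0%R, 1%R]) (g' t)%:E =
    (g 1)%:E - (g 0)%:E)%E.
  apply: continuous_FTC2 => //; first exact: continuous_subspaceT.
    split; first by move=> t _; have [] := gD t.
    - exact/cvg_at_right_filter/cg.
    - exact/cvg_at_left_filter/cg.
  by move=> t _; rewrite derive1E; have [] := gD t.
rewrite -abse_EFin EFinB -FTC.
apply: le_trans (le_abse_integral _ _ _) _ => //; first exact: mc.
apply: ge0_le_integral => //.
- by apply: measurableT_comp => //; exact: mc.
- exact: mc.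
- by move=> t _; rewrite lee_fin; exact: sum_partial_le_grad_norm.
Qed.

End directional_derivatives.

(** * The inequality for finitely many points *)

Lemma gt0_powRD (R : realType) (x r s : R) : 0 < x ->
  x `^ (r + s) = x `^ r * x `^ s.
Proof. by move=> x0; apply: powRD; rewrite (gt_eqF x0) implybT. Qed.

Section finite_hardy.
Context {R : realType} {n : nat}.
Local Notation mu := (@lebesgue_measure R).

(** The antiderivative is [t ^ p / p]; [a = 1] is separate because the interval degenerates to a
    point. *)
Lemma integral_powR_itv (a p : R) : 0 < a <= 1 -> 0 < p ->
  (\int[mu]_(t in `[a, 1%R]) (t `^ (p - 1))%:E = (p^-1 * (1 - a `^ p))%:E)%E.
Proof.
move=> /andP[a0]; rewrite le_eqVlt => /predU1P[->|a1] p0.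
  by rewrite set_itv1 integral_set1 powR1 subrr mulr0.
have cpow q : {in `[a, 1], continuous (fun t : R => t `^ q)}.
  move=> t; rewrite in_itv/= => /andP[ta _].
  apply: differentiable_continuous; apply/derivable1_diffP.
  by have [] := is_derive1_powR q (lt_le_trans a0 ta).
have dF (t : R) : 0 < t -> is_derive t 1 (fun t : R => p^-1 * t `^ p) (t `^ (p - 1)).
  move=> t0; have := is_derive1_powR p t0 => ?.
  by apply: is_derive_eq; rewrite /GRing.scale/= mulrA mulVf ?mul1r// gt_eqF.
have cF t : t \in `[a, 1] -> {for t, continuous (fun t : R => p^-1 * t `^ p)}.
  by move=> ta; apply: cvgM; [exact: cvg_cst|exact: cpow].
rewrite (@continuous_FTC2 _ _ (fun t => p^-1 * t `^ p))//.
- by rewrite -EFinB powR1 -mulrBr.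
- by apply: continuous_in_subspaceT => t; rewrite inE/=; exact: cpow.
- split.
  + move=> t; rewrite in_itv/= => /andP[ta _].
    by have [] := dF t (lt_trans a0 ta).
  + by apply: cvg_at_right_filter; apply: cF; rewrite in_itv/= lexx ltW.
  + by apply: cvg_at_left_filter; apply: cF; rewrite in_itv/= lexx ltW.
- move=> t; rewrite in_itv/= => /andP[ta _].
  by rewrite derive1E; have [] := dF t (lt_trans a0 ta).
Qed.

Variables (u : 'rV[R]_n -> R).
Hypothesis du : forall (i : 'I_n) x, derivable u x (delta_mx 0 i).
Hypothesis cdu : forall i : 'I_n, continuous (partial i u).
Hypothesis cu : continuous u.
Variables (q : 'rV[R]_n) (Y : seq 'rV[R]_n) (rho s : R).
Hypothesis uY : forall y, y \in q :: Y -> u y = 0.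
Let D x := enorm (x - nearest q Y x).
Hypothesis rho0 : 0 < rho.
Hypothesis u_rho : forall x, u x != 0 -> D x <= rho.
Hypothesis grad_rho : forall x, grad_norm u x != 0 -> D x <= rho.
Hypothesis s1 : 1 < s.
Hypothesis sn : n%:R < s.

(* At [z = pull t x] with [D x <= rho] this is [grad_norm u z * D x `^ (1 - s)],
   but written as a function of [t] and [z] alone. *)
Let H (t : R) (z : 'rV[R]_n) : R :=
  if (0 < t) && (t <= 1) && (D z <= t * rho)
  then grad_norm u z * D z `^ (1 - s) * t `^ (s - 1) else 0.

Let grad_norm_ge0 z : 0 <= grad_norm u z. Proof. exact: sqrtr_ge0. Qed.

Let H_ge0 t z : 0 <= H t z.
Proof. by rewrite /H; case: ifP => // _; rewrite !mulr_ge0 ?powR_ge0. Qed.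

Let D_pull t x : 0 <= t <= 1 -> D (pull q Y t x) = t * D x.
Proof.
move=> t01; rewrite /D pull_sub_nearest// enormZ ger0_norm//.
by case/andP: t01.
Qed.

Let measurable_D : measurable_fun setT (D : mrV R n -> R).
Proof.
apply: measurable_enorm; apply: measurable_funB_rV => //.
exact: measurable_nearest.
Qed.

Let measurable_gn : measurable_fun setT (grad_norm u : mrV R n -> measurableTypeR R).
Proof. by apply: continuous_measurable_rV; exact: continuous_grad_norm. Qed.

Let measurable_H : measurable_fun setT
  ((fun z => H z.1 z.2) : measurableTypeR R * mrV R n -> measurableTypeR R).
Proof.
have m1 : measurable_fun setT (fst : measurableTypeR R * mrV R n -> measurableTypeR R).
  exact: measurable_fst.
have mD2 : measurable_fun setT ((fun z => D z.2) : measurableTypeR R * mrV R n -> R).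
  exact: (measurableT_comp measurable_D).
apply: measurable_fun_ifT => //.
  apply: measurable_and; last by apply: measurable_fun_ler => //; exact: measurable_funM.
  by apply: measurable_and; [exact: measurable_fun_ltr|exact: measurable_fun_ler].
apply: measurable_funM; last exact: (measurableT_comp (measurable_powR _)).
apply: measurable_funM; first exact: (measurableT_comp measurable_gn).
exact: (measurableT_comp (measurable_powR _)).
Qed.

(** The segment starts at a nearest point, where [u] vanishes, so the increment of [u] along it is
    [u x]; its integral bound is then multiplied by [D x ^ (- s)]. *)
Let segment_bound x :
  ((`|u x| * D x `^ (- s))%:E <= \int[mu]_t (H t (pull q Y t x))%:E)%E.
Proof.
have [ux0|ux0] := eqVneq (u x) 0.
  rewrite ux0 normr0 mul0r; apply: integral_ge0 => t _.
  by rewrite lee_fin H_ge0.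
have Dx0 : 0 < D x.
  rewrite lt_def enorm_ge0 andbT enorm_eq0 subr_eq0; apply: contra_neq ux0 => ->.
  exact/uY/nearest_in.
(* Since [D] scales by [t], the cutoff in [H] reads [D x <= rho], which holds as [u x] is nonzero,
   and the factor [t ^ (s - 1)] cancels the [t ^ (1 - s)] coming from [D]. *)
have H01 t : t \in `]0, 1] ->
    H t (pull q Y t x) = grad_norm u (pull q Y t x) * D x * D x `^ (- s).
  rewrite in_itv/= => /andP[t0 t1].
  have t01 : 0 <= t <= 1 by rewrite (ltW t0).
  rewrite /H t0 t1 D_pull//= ler_pM2l// u_rho//.
  rewrite powRM ?ltW// -!mulrA; congr (_ * _).
  rewrite mulrCA -gt0_powRD// (_ : 1 - s + (s - 1) = 0) ?powRr0 ?mulr1; last by ring.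
  by rewrite gt0_powRD// powRr1// ltW.
have -> : (\int[mu]_t (H t (pull q Y t x))%:E =
    \int[mu]_(t in `]0%R, 1%R])
       (grad_norm u (pull q Y t x) * D x * D x `^ (- s))%:E)%E.
  rewrite [RHS]integral_mkcond; apply: eq_integral => t _.
  rewrite patchE mem_setE; case: ifPn => [/H01 ->//|].
  by rewrite in_itv/= /H => /negbTE ->.
have cline : continuous (fun t : R => pull q Y t x).
  move=> t; apply: cvgD; first exact: cvg_cst.
  by apply: cvgZr_tmp; exact: cvg_id.
have mg : measurable_fun setT ((fun t => grad_norm u (pull q Y t x) * D x)
    : measurableTypeR R -> measurableTypeR R).
  apply: continuous_measurable_fun => t; apply: cvgM; last exact: cvg_cst.
  exact: (cvg_comp _ _ (cline t) (@continuous_grad_norm _ _ u cdu (pull q Y t x))).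
rewrite integral_itv_obnd_cbnd; last first.
  apply/measurable_EFinP; apply: measurable_funTS.
  by apply: measurable_funM.
under eq_integral do rewrite EFinM muleC.
rewrite ge0_integralZl//; last 3 first.
- by apply/measurable_EFinP; apply: measurable_funTS.
- by move=> t _; rewrite lee_fin mulr_ge0// enorm_ge0.
- by rewrite lee_fin powR_ge0.
rewrite EFinM muleC lee_pmul2l// ?lte_fin ?powR_gt0//.
have := @increment_le_integral_grad_norm R n u (nearest q Y x)
  (x - nearest q Y x) du cdu.
by rewrite subrKC (uY (nearest_in _ _ _)) subr0.
Qed.

(** Up to the factor [(s - n%:R)^-1], this is the result of the integration in [t]. *)
Let weight z : R := grad_norm u z * D z `^ (1 - s) * (1 - (D z / rho) `^ (s - n%:R)).

Let time_integral z :
  (\int[mu]_t ((t : R) `^ (- n%:R) * H t z)%:E <= ((s - n%:R)^-1 * weight z)%:E)%E.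
Proof.
have sn0 : 0 < s - n%:R by rewrite subr_gt0.
have [g0|g0] := eqVneq (grad_norm u z) 0.
  rewrite /weight g0 !mul0r mulr0 integral0_eq// => t _.
  by rewrite /H g0 !mul0r if_same mulr0.
(* As [1 - s] is nonzero, the convention for real powers gives [0 ^ (1 - s) = 0], so both sides
   vanish at the chosen points. *)
have [D0|D0] := eqVneq (D z) 0.
  have s10 : 1 - s != 0 by rewrite subr_eq0 lt_eqF.
  rewrite /weight D0 powR0// mulr0 mul0r mulr0 integral0_eq// => t _.
  by rewrite /H D0 powR0// mulr0 mul0r if_same mulr0.
have Dz0 : 0 < D z by rewrite lt_def D0 enorm_ge0.
have Drho := grad_rho g0.
(* The cutoff [D z <= t * rho] turns [D z / rho] into the lower limit of integration. *)
have a01 : 0 < D z / rho <= 1 by rewrite divr_gt0//= ler_pdivrMr// mul1r.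
have -> : (\int[mu]_t ((t : R) `^ (- n%:R) * H t z)%:E =
   \int[mu]_(t in `[(D z / rho)%R, 1%R])
     ((grad_norm u z * D z `^ (1 - s))%:E * ((t : R) `^ (s - n%:R - 1))%:E))%E.
  rewrite [RHS]integral_mkcond; apply: eq_integral => t _.
  rewrite patchE mem_setE in_itv/= /H -ler_pdivrMr//.
  have [ta|] := leP (D z / rho) t; last by rewrite andbF mulr0.
  have t0 : 0 < t by apply: lt_le_trans ta; case/andP: a01.
  rewrite t0 andbT /=; case: ifP => _; last by rewrite mulr0.
  rewrite -EFinM; congr EFin; rewrite mulrCA; congr (_ * _).
  by rewrite -gt0_powRD//; congr (_ `^ _); ring.
rewrite ge0_integralZl//; last 3 first.
- by apply/measurable_EFinP; apply: measurable_funTS; exact: measurable_powR.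
- by move=> t _; rewrite lee_fin powR_ge0.
- by rewrite lee_fin mulr_ge0 ?powR_ge0.
by rewrite integral_powR_itv// -EFinM lee_fin mulrCA.
Qed.

Let weight_ge0 z : 0 <= weight z.
Proof.
rewrite /weight; have [->|g0] := eqVneq (grad_norm u z) 0; first by rewrite !mul0r.
rewrite !mulr_ge0 ?powR_ge0// subr_ge0.
have le1 : D z / rho <= 1 by rewrite ler_pdivrMr// mul1r grad_rho.
have := @ge0_ler_powR R (s - n%:R) _ (D z / rho) 1; rewrite powR1; apply=> //.
- by rewrite subr_ge0 ltW.
- by rewrite nnegrE divr_ge0// ?enorm_ge0 ?ltW.
- by rewrite nnegrE.
Qed.

Let measurable_weight : measurable_fun setT (weight : mrV R n -> R).
Proof.
apply: measurable_funM.
  by apply: measurable_funM => //; exact: (measurableT_comp (measurable_powR _)).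
apply: measurable_funB => //; apply: (measurableT_comp (measurable_powR _)) => /=.
exact: measurable_funM.
Qed.

(** The chain is: [segment_bound] at each [x], Tonelli, [integralRn_pull] at each [t], Tonelli
    again, [time_integral] at each [z]. *)
Lemma finite_hardy :
  ((s - n%:R)%:E * integralRn (fun x => (`|u x| * D x `^ (- s))%:E) <=
   integralRn (fun z => (weight z)%:E))%E.
Proof.
have sn0 : 0 < s - n%:R by rewrite subr_gt0.
pose F1 (z : measurableTypeR R * mrV R n) := (H z.1 (pull q Y z.1 z.2))%:E.
pose F2 (z : measurableTypeR R * mrV R n) := ((z.1 : R) `^ (- n%:R) * H z.1 z.2)%:E.
have mF1 : measurable_fun setT F1.
  apply/measurable_EFinP.
  have mp : measurable_fun setT ((fun z => (z.1, pull q Y z.1 z.2)) :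
      measurableTypeR R * mrV R n -> measurableTypeR R * mrV R n).
    by apply: measurable_fun_pair; [exact: measurable_fst|exact: measurable_pull].
  exact: (measurableT_comp measurable_H mp).
have mF2 : measurable_fun setT F2.
  apply/measurable_EFinP; apply: measurable_funM => //.
  by apply: (measurableT_comp (measurable_powR _)); exact: measurable_fst.
have F10 z : (0 <= F1 z)%E by rewrite lee_fin H_ge0.
have F20 z : (0 <= F2 z)%E.
  by rewrite lee_fin mulr_ge0 ?powR_ge0 ?H_ge0.
have mH t : measurable_fun setT (fun z : mrV R n => (H t z)%:E).
  apply/measurable_EFinP.
  exact: (measurable_slice (t : measurableTypeR R) measurable_H).
have step1 : (integralRn (fun x => (`|u x| * D x `^ (- s))%:E) <=
    integralRn (fun x => \int[mu]_t F1 (t, x)))%E.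
  apply: le_integralRn.
  - apply/measurable_EFinP; apply: measurable_funM.
      apply: measurableT_comp => //; exact: continuous_measurable_rV.
    exact: (measurableT_comp (measurable_powR _)).
  - exact: (measurable_fun_fubini_tonelli_G (m1 := mu) F1).
  - by move=> x; rewrite lee_fin mulr_ge0// powR_ge0.
  - by move=> x; exact: segment_bound.
have step2 : (\int[mu]_t integralRn (fun x => F1 (t, x)) <=
    \int[mu]_t integralRn (fun x => F2 (t, x)))%E.
  apply: ge0_le_integral => //.
  - by move=> t _; apply: integralRn_ge0 => x; exact: F10.
  - exact: measurable_integralRn.
  - exact: measurable_integralRn.
  move=> t _; have [t01|t01] := boolP (0 < t <= 1).
    rewrite /F2/=; under [X in (_ <= integralRn X)%E]eq_fun do rewrite EFinM.
    rewrite integralRnZl//; last 2 first.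
    - by rewrite lee_fin powR_ge0.
    - by move=> z; rewrite lee_fin H_ge0.
    rewrite powR_invn ?(ltW (andP t01).1)// -exprVn.
    apply: (@integralRn_pull _ _ q Y t (fun z => (H t z)%:E)) => // z.
    by rewrite lee_fin H_ge0.
  (* For [t] outside []0, 1]] the cutoff makes [H t] vanish identically. *)
  rewrite /F1 /F2 /=.
  under [X in (integralRn X <= _)%E]eq_fun do rewrite /H (negbTE t01)/=.
  rewrite integralRn0; apply: integralRn_ge0 => x.
  by rewrite lee_fin mulr_ge0 ?powR_ge0 ?H_ge0.
have step3 : (integralRn (fun x => \int[mu]_t F2 (t, x)) <=
    integralRn (fun z => ((s - n%:R)^-1)%:E * (weight z)%:E))%E.
  apply: le_integralRn.
  - exact: (measurable_fun_fubini_tonelli_G (m1 := mu) F2).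
  - by apply/measurable_EFinP; exact: measurable_funM.
  - by move=> x; exact: integral_ge0.
  - by move=> x; exact: time_integral.
rewrite muleC -lee_pdivlMr// [leRHS]muleC.
rewrite -integralRnZl//; last 2 first.
- exact/measurable_EFinP.
- by rewrite lee_fin invr_ge0 ltW.
apply: le_trans step3; rewrite -fubini_integralRn//.
by apply: le_trans step2; rewrite fubini_integralRn.
Qed.

End finite_hardy.

(** * Distance to the complement *)

Section distance.
Context {R : realType} {n : nat}.
Variable Om : set 'rV[R]_n.
Hypothesis Om_proper : Om != setT.
Implicit Types x y z : 'rV[R]_n.

Lemma exists_notin_proper : exists y, ~ Om y.
Proof.
apply: contra_notP (elimN eqP Om_proper); move=> /forallNP h.
by apply/seteqP; split => // x _; have /contrapT := h x.
Qed.

Let dist_set_neq0 x : [set enorm (x - y) | y in ~` Om] !=set0.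
Proof. by have [y Oy] := exists_notin_proper; exists (enorm (x - y)), y. Qed.

Lemma dist_compl_le x y : ~ Om y -> dist_compl Om x <= enorm (x - y).
Proof.
by move=> Oy; apply: ge_inf; [exists 0 => _ [z _ <-]; exact: enorm_ge0|exists y].
Qed.

Lemma dist_compl_lt x (c : R) : dist_compl Om x < c ->
  exists2 y, ~ Om y & enorm (x - y) < c.
Proof. by move=> /(inf_lt (dist_set_neq0 x))[_ [y Oy <-]]; exists y. Qed.

Lemma dist_compl_lipschitz x z : dist_compl Om x <= enorm (x - z) + dist_compl Om z.
Proof.
rewrite -lerBlDl; apply: lb_le_inf => // _ [y Oy <-].
rewrite lerBlDl; apply: le_trans (dist_compl_le x Oy) _.
by rewrite -[x - y](subrKA z) enormD.
Qed.

Lemma continuous_dist_compl : continuous (dist_compl Om).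
Proof.
move=> x.
suff : dist_compl Om z @[z --> nbhs x] --> dist_compl Om x by [].
apply/cvgrPdist_lt => e e0.
have cx : enorm (x - z) @[z --> x] --> (0 : R).
  have p : x - z @[z --> nbhs x] --> x - x by apply: cvgB; [exact: cvg_cst|].
  have := cvg_comp _ _ p (@continuous_enorm R n (x - x)).
  by rewrite subrr enorm0.
near=> z.
have : enorm (x - z) < e.
  rewrite -[ltLHS]ger0_norm ?enorm_ge0//; near: z.
  exact: (cvgr0_norm_lt _ cx).
apply: le_lt_trans; rewrite ler_norml; apply/andP; split.
  by rewrite lerBrDr addrC lerBlDr (le_trans (dist_compl_lipschitz z x))// enormB addrC.
by rewrite lerBlDr dist_compl_lipschitz.
Unshelve. all: by end_near. Qed.

Lemma dist_compl_gt0 x : open Om -> Om x -> 0 < dist_compl Om x.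
Proof.
move=> oO Ox.
have /nbhs_ballP[e /= e0 eO] := open_nbhs_nbhs (conj oO Ox).
apply: (lt_le_trans e0); apply: lb_le_inf => // _ [y Oy <-].
rewrite leNgt; apply/negP => xy; apply: Oy; apply: eO; split=> // i j.
rewrite /ball/= ord1; apply: le_lt_trans xy.
by have := coord_le_enorm (x - y) j; rewrite !mxE.
Qed.

(** The open sets where [enorm (x - y) < k * dist_compl Om x], for [y] outside [Om], cover [K]
    because the distance is positive there and [k > 1]. The indices of a finite subcover are the
    required points. *)
Lemma finite_almost_nearest (K : set 'rV[R]_n) (k : R) :
  open Om -> compact K -> K `<=` Om -> 1 < k ->
  exists s : seq 'rV[R]_n, (forall y, y \in s -> ~ Om y) /\
    (forall x, K x -> exists2 y, y \in s & enorm (x - y) <= k * dist_compl Om x).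
Proof.
move=> oO; rewrite compact_cover => cK KO k1.
have [||F FO KF] := cK _ (~` Om) (fun y => [set x | enorm (x - y) < k * dist_compl Om x]).
- move=> y _.
  have -> : [set x | enorm (x - y) < k * dist_compl Om x] =
      (fun x => k * dist_compl Om x - enorm (x - y)) @^-1` [set r | 0 < r].
    by apply/seteqP; split => x /=; rewrite subr_gt0.
  apply: open_comp; last exact: open_gt.
  move=> x _.
  suff : k * dist_compl Om z - enorm (z - y) @[z --> nbhs x] -->
      k * dist_compl Om x - enorm (x - y) by [].
  apply: cvgB.
    by apply: cvgMl_tmp; exact: continuous_dist_compl.
  have p : z - y @[z --> nbhs x] --> x - y by apply: cvgB; [|exact: cvg_cst].
  exact: (cvg_comp _ _ p (@continuous_enorm R n (x - y))).
- move=> x Kx; have dx := dist_compl_gt0 oO (KO x Kx).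
  have [y Oy xy] : exists2 y, ~ Om y & enorm (x - y) < k * dist_compl Om x.
    by apply: dist_compl_lt; rewrite ltr_pMl.
  by exists y.
exists (finmap.enum_fset F); split=> [y yF|x Kx].
  by have := FO y yF; rewrite inE.
by have [y yF /ltW xy] := KF x Kx; exists y.
Qed.

End distance.

(** Expanding gives [D ^ (1 - s) - (k r) ^ (n - s) D ^ (1 - n)]. The first term is controlled by
    [d <= D]; by [D <= k d] the second is at least [k ^ (1 - s) r ^ (n - s) d ^ (1 - n)]. Lowering
    the exponent of [k] to [- s] matches the factor lost in the term with [u]. *)
Lemma hardy_weight_le (R : realType) (d D k r s n : R) :
  0 < d -> d <= D -> D <= k * d -> 1 < k -> 0 < r -> 1 <= n -> n < s ->
  D `^ (1 - s) * (1 - (D / (k * r)) `^ (s - n)) + k `^ (- s) * r `^ (n - s) / d `^ (n - 1)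
  <= (d `^ (s - 1))^-1.
Proof.
move=> d0 dD Dkd k1 r0 n1 ns.
have D0 : 0 < D by exact: lt_le_trans dD.
have k0 : 0 < k by exact: lt_trans k1.
have kr0 : 0 < k * r by rewrite mulr_gt0.
have le_neg (x y p : R) : 0 < x -> x <= y -> 0 <= p -> y `^ (- p) <= x `^ (- p).
  move=> x0 xy p0; have y0 := lt_le_trans x0 xy.
  rewrite !powRN lef_pV2 ?posrE ?powR_gt0//.
  by rewrite ge0_ler_powR// nnegrE ltW.
have A1 : D `^ (1 - s) <= (d `^ (s - 1))^-1.
  by rewrite -powRN -opprB le_neg//; lra.
have E : D `^ (1 - s) * (D / (k * r)) `^ (s - n) = (k * r) `^ (n - s) * D `^ (1 - n).
  rewrite powRM ?invr_ge0 ?(ltW D0) ?(ltW kr0)// -[_^-1]powR_inv1 ?(ltW kr0)//.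
  rewrite -powRrM mulN1r opprB mulrA -gt0_powRD// mulrC; congr (_ * _ `^ _); ring.
rewrite mulrBr mulr1 E.
suff : k `^ (- s) * r `^ (n - s) / d `^ (n - 1) <= (k * r) `^ (n - s) * D `^ (1 - n).
  by move: A1; lra.
have A2 : (k * d) `^ (1 - n) <= D `^ (1 - n).
  by rewrite -opprB le_neg//; lra.
apply: le_trans (ler_wpM2l (powR_ge0 _ _) A2).
rewrite -powRN opprB !powRM ?(ltW k0) ?(ltW r0) ?(ltW d0)//.
rewrite [leRHS]mulrACA -gt0_powRD// -mulrA ler_wpM2r ?mulr_ge0 ?powR_ge0//.
by apply: ler_powR; [exact: ltW|lra].
Qed.

(** * Measurability and finiteness of integrals over [Om] *)

Section integral_on.
Context {R : realType} {n : nat}.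
Variable Om : set 'rV[R]_n.
Hypothesis Om_open : open Om.

Lemma measurable_on (g : mrV R n -> measurableTypeR R) : measurable_fun setT g ->
  measurable_fun setT
    ((fun x => if x \in Om then (g x)%:E else 0%E) : mrV R n -> \bar R).
Proof.
move=> mg; apply/(measurable_restrictT (EFin \o g) (measurable_open Om_open)).
by apply/measurable_EFinP; exact: measurable_funTS.
Qed.

Lemma on_ge0 (g : 'rV[R]_n -> R) x : (forall x, 0 <= g x) ->
  (0 <= if x \in Om then (g x)%:E else 0)%E.
Proof. by move=> g0; case: ifP => // _; rewrite lee_fin. Qed.

Lemma integral_on_set0 (g : 'rV[R]_n -> R) : Om = set0 -> integral_on Om g = 0%E.
Proof.
move=> O0; rewrite /integral_on -[RHS](integralRn0 n); congr integralRn.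
by apply/funext => x; rewrite O0 in_set0.
Qed.

(** The integrand is dominated by the absolute value of [M] times the indicator of a cube containing
    [K]. *)
Lemma integral_on_lty (g : mrV R n -> measurableTypeR R) (K : set 'rV[R]_n) (M : R) :
  measurable_fun setT g -> (forall x, 0 <= g x) -> compact K ->
  (forall x, Om x -> K x -> g x <= M) -> (forall x, Om x -> ~ K x -> g x = 0) ->
  (integral_on Om g < +oo)%E.
Proof.
move=> mg g0 cK gM gK.
have [N0 [_ KN0]] := compact_bounded cK.
(* Boundedness supplies a bound only for numbers strictly above [N0], hence the added 1. *)
pose N := `|N0| + 1.
have N0' : 0 <= N by rewrite addr_ge0.
have KN x : K x -> forall i, `|x 0 i| <= N.
  move=> Kx i; have := KN0 N; rewrite ltr_pwDr ?ler_norm// => /(_ isT x Kx).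
  apply: le_trans; rewrite [leRHS]/Num.norm/= mx_normrE.
  exact: (le_bigmax _ (fun ij => `|x ij.1 ij.2|) (0, i)).
pose box (x : 'rV[R]_n) : \bar R := 
    if `[< forall i, `|x 0 i| <= N >] then 1%E else 0%E.
have box0 x : (0 <= box x)%E by rewrite /box; case: ifP.
have mbox : measurable_fun setT (box : mrV R n -> \bar R).
  have mb : measurable
      ([set x : 'rV[R]_n | forall i, `|x 0 i| <= N] : set (mrV R n)).
    have -> : [set x : 'rV[R]_n | forall i, `|x 0 i| <= N] =
        \bigcap_(i in [set: 'I_n]) [set x : 'rV[R]_n | `|x 0 i| <= N].
      by apply/seteqP; split => x /= h i; [move=> _; exact: h|exact: h].
    apply: (@fin_bigcap_measurable _ (mrV R n)) => // i _.
    have := measurable_coord i measurableT (measurable_itv `[- N, N]).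
    by rewrite setTI; under [X in measurable X]eq_set do rewrite /= in_itv/= -ler_norml.
  have : measurable_fun setT
    ((EFin \o (\1_[set x : 'rV[R]_n | forall i, `|x 0 i| <= N] : _ -> R)) : mrV R n -> \bar R).
    by apply/measurable_EFinP; exact: measurable_indic.
  congr measurable_fun; apply/funext => x; rewrite /= indicE /box.
  by case: asboolP => h; [rewrite mem_set|rewrite memNset].
apply: (@le_lt_trans _ _ (`|M|%:E * integralRn box)%E).
  rewrite -integralRnZl//.
  apply: le_integralRn.
  - exact: measurable_on.
  - exact: measurable_funeM.
  - by move=> x; exact: on_ge0.
  move=> x; case: ifPn => [/set_mem Ox|_]; last first.
    by rewrite mule_ge0// lee_fin.
  have [Kx|Kx] := pselect (K x); last first.
    by rewrite gK// mule_ge0// lee_fin.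
  rewrite /box; case: asboolP => [_|]; last by move=> /(_ (KN x Kx)).
  by rewrite mule1 lee_fin (le_trans (gM x Ox Kx))// ler_norm.
have := integralRn_box_lty n N0'; rewrite -/box => box_lty.
by rewrite lte_mul_pinfty ?lee_fin.
Qed.

End integral_on.

(** * From finitely many points to the distance function *)

Theorem theorem2p7 (R : realType) (n : nat) (Om : set 'rV[R]_n)
  (hOm_open : open Om) (hOm_proper : Om != setT)
  (hR : exists M : R, forall x, Om x -> dist_compl Om x <= M)
  (u : 'rV[R]_n -> R) (hu : Cc_infty Om u) (s : R) (hs : n%:R < s) :
  let d := dist_compl Om in
  let Rsup := sup [set d x | x in Om] in
  ((Rsup `^ (n%:R - s))%R%:E *
     integral_on Om (fun x => (grad_norm u x / d x `^ (n%:R - 1))%R)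
   <= integral_on Om (fun x => (grad_norm u x / d x `^ (s - 1))%R)
      - (s - n%:R)%R%:E * integral_on Om (fun x => (`|u x| / d x `^ s)%R))%E.
Proof.
pose d := dist_compl Om; pose Rsup := sup [set d x | x in Om].
cbv zeta; rewrite -/d -/Rsup.
have [Om0|/set0P[x0 Ox0]] := eqVneq Om set0.
  by rewrite !integral_on_set0// !mule0 sube0.
have sn0 : 0 < s - n%:R by rewrite subr_gt0.
(* In dimension 0 the space is a single point, so a nonempty [Om] would be the whole space. *)
have n1 : 1 <= n%:R :> R.
  rewrite ler1n lt0n; apply/eqP => n0.
  move/eqP: hOm_proper; apply; apply/seteqP; split => // y _.
  suff -> : y = x0 by [].
  by apply/rowP => -[i im]; exfalso; move: im; rewrite n0.
have s1 : 1 < s by exact: le_lt_trans hs.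
have s0 : 0 < s by exact: lt_trans s1.
have [usm [cK KOm]] := hu.
set K := closure _ in cK KOm.
have cu : continuous u by have [] := usm [::].
have du (i : 'I_n) x : derivable u x (delta_mx 0 i) by have [_] := usm [::]; exact.
have cdu (i : 'I_n) : continuous (partial i u) by have [] := usm [:: i].
have uK x : u x != 0 -> K x by move=> ux; exact: subset_closure.
(* Off the closed set [K] the function [u] is locally zero, hence so are its partial derivatives. *)
have gK x : grad_norm u x != 0 -> K x.
  apply: contra_neqP => nKx; rewrite /grad_norm big1 ?sqrtr0// => i _.
  suff -> : partial i u x = 0 by rewrite expr0n.
  rewrite /partial (@near_eq_derive _ _ _ u (cst 0)) ?derive_cst//.
  have : nbhs x (~` K).
    by apply: open_nbhs_nbhs; split => //; apply: closed_openC; exact: closed_closure.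
  by apply: filterS => z; apply: contra_notP => /eqP; exact: uK.
have d_gt0 x : Om x -> 0 < d x by exact: dist_compl_gt0.
have md : measurable_fun setT (d : mrV R n -> measurableTypeR R).
  by apply: continuous_measurable_rV; exact: continuous_dist_compl.
have mg : measurable_fun setT (grad_norm u : mrV R n -> measurableTypeR R).
  by apply: continuous_measurable_rV; exact: continuous_grad_norm.
have mu : measurable_fun setT ((fun x => `|u x|) : mrV R n -> measurableTypeR R).
  apply: (measurableT_comp (f := @Num.norm R R)) => //.
  exact: continuous_measurable_rV.
have mdiv (f : mrV R n -> measurableTypeR R) p : measurable_fun setT f ->
    measurable_fun setT ((fun x => f x / d x `^ p) : mrV R n -> measurableTypeR R).
  move=> mf; under eq_fun do rewrite -powRN.
  by apply: measurable_funM => //; exact: (measurableT_comp (measurable_powR _)).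
have g0 x : 0 <= grad_norm u x by exact: sqrtr_ge0.
have div0 (f : 'rV[R]_n -> R) p x : (forall x, 0 <= f x) -> 0 <= f x / d x `^ p.
  by move=> f0; rewrite divr_ge0// powR_ge0.
have dRsup x : Om x -> d x <= Rsup.
  move=> Ox; apply: ub_le_sup; last by exists x.
  by have [M hM] := hR; exists M => _ [y Oy <-]; exact: hM.
have Rsup0 : 0 < Rsup by apply: lt_le_trans (dRsup _ Ox0); exact: d_gt0.
set A := integral_on Om (fun x => grad_norm u x / d x `^ (s - 1)).
set B := integral_on Om (fun x => `|u x| / d x `^ s).
set C := integral_on Om (fun x => grad_norm u x / d x `^ (n%:R - 1)).
have B0 : (0 <= B)%E.
  apply: integralRn_ge0 => x.
  apply: (@on_ge0 _ _ Om (fun x => `|u x| / d x `^ s) x) => y.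
  exact: (div0 (fun y => `|u y|)).
have C0 : (0 <= C)%E.
  apply: integralRn_ge0 => x.
  apply: (@on_ge0 _ _ Om (fun x => grad_norm u x / d x `^ (n%:R - 1)) x) => y.
  exact: div0.
(* Finiteness allows the subtracted term to be moved across the inequality in the extended reals.
   The bound on [K] uses the minimum of [d] and the maximum of the absolute value of [u], which
   exist once [K] is nonempty. *)
have Boo : (B < +oo)%E.
  have [K0|/set0P K0] := eqVneq K set0.
    apply: (@integral_on_lty _ _ Om hOm_open _ K 0) => //; first exact: mdiv.
    - by move=> x; apply: (div0 (fun y => `|u y|)).
    - by move=> x _; rewrite K0.
    - move=> x _ nKx; have [->|/uK//] := eqVneq (u x) 0.
      by rewrite normr0 mul0r.
  have [c cK' dc] := compact_EVT_min K0 cK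
    (continuous_subspaceT (continuous_dist_compl hOm_proper)).
  have [e eK ue] := compact_EVT_max K0 cK (continuous_subspaceT
    (fun x => continuous_comp (cu x) (@norm_continuous R R^o (u x)))).
  apply: (@integral_on_lty _ _ Om hOm_open (fun x => `|u x| / d x `^ s) K
    (`|u e| / d c `^ s) _ _ cK).
  - exact: mdiv.
  - by move=> x; apply: (div0 (fun y => `|u y|)).
  - move=> x _ Kx; have dc0 := d_gt0 c (KOm c (set_mem cK')).
    have dcx : d c <= d x by exact/dc/mem_set.
    have uex : `|u x| <= `|u e| by exact/ue/mem_set.
    have dx0 := lt_le_trans dc0 dcx.
    (* With [dc] and [ue] in the context [done] unfolds [dist_compl] and diverges. *)
    clear dc ue; apply: ler_pM; [exact: normr_ge0| |exact: uex|].
      by rewrite invr_ge0 powR_ge0.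
    rewrite lef_pV2 ?posrE; [|exact: powR_gt0|exact: powR_gt0].
    by apply: ge0_ler_powR; rewrite ?nnegrE; [exact: ltW|exact: ltW|exact: ltW|].
  - move=> x _ nKx; have [->|/uK//] := eqVneq (u x) 0.
    by rewrite normr0 mul0r.
(* This is the theorem up to the factor [k ^ (- s)]: [finite_hardy] with [rho = k * Rsup], then a
   return from [D] to [d] on each side, in [low] and [high]. *)
have key (k : R) : 1 < k -> ((k `^ (- s))%:E * ((Rsup `^ (n%:R - s))%:E * C +
    (s - n%:R)%:E * B) <= A)%E.
  move=> k1; have k0 : 0 < k by exact: lt_trans k1.
  have [Y [YO KY]] := finite_almost_nearest hOm_proper hOm_open cK KOm k1.
  have [q Oq] := exists_notin_proper hOm_proper.
  have qYO y : y \in q :: Y -> ~ Om y.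
    by rewrite inE => /orP[/eqP->//|]; exact: YO.
  pose D x := enorm (x - nearest q Y x).
  have dD x : d x <= D x by apply: dist_compl_le; apply/qYO/nearest_in.
  have Dkd x : K x -> D x <= k * d x.
    move=> /KY[y yY]; apply: le_trans; apply: nearest_min.
    by rewrite inE yY orbT.
  have Drho x : K x -> D x <= k * Rsup.
    move=> Kx; apply: le_trans (Dkd x Kx) _.
    by rewrite ler_pM2l// dRsup//; exact: KOm.
  have uY y : y \in q :: Y -> u y = 0.
    move=> /qYO nOy; apply/eqP; apply: contra_notT nOy => /uK; exact: KOm.
  have := @finite_hardy R n u du cdu cu q Y (k * Rsup) s uY (mulr_gt0 k0 Rsup0)
    (fun x ux => Drho x (uK x ux)) (fun x gx => Drho x (gK x gx)) s1 hs.
  pose w x := grad_norm u x * D x `^ (1 - s) * (1 - (D x / (k * Rsup)) `^ (s - n%:R)).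
  rewrite -/D -[X in (_ <= X)%E]/(integralRn (fun x => (w x)%:E)) => hardy.
  have mD : measurable_fun setT (D : mrV R n -> measurableTypeR R).
    apply: measurable_enorm; apply: measurable_funB_rV => //.
    exact: measurable_nearest.
  have mw : measurable_fun setT (w : mrV R n -> measurableTypeR R).
    apply: measurable_funM.
      by apply: measurable_funM => //; exact: (measurableT_comp (measurable_powR _)).
    apply: measurable_funB => //; apply: (measurableT_comp (measurable_powR _)) => /=.
    exact: measurable_funM.
  have w0 x : 0 <= w x.
    rewrite /w; have [->|gx] := eqVneq (grad_norm u x) 0; first by rewrite !mul0r.
    rewrite !mulr_ge0 ?powR_ge0// subr_ge0.
    have := @ge0_ler_powR R (s - n%:R) (ltW sn0) (D x / (k * Rsup)) 1.
    rewrite powR1 !nnegrE; apply=> //.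
      by rewrite divr_ge0 ?enorm_ge0// mulr_ge0// ltW.
    by rewrite ler_pdivrMr ?mulr_gt0// mul1r; exact/Drho/gK.
  (* Where [u] is nonzero, [D <= k * d] gives [(k d) ^ (- s) <= D ^ (- s)]. *)
  have low : ((k `^ (- s))%:E * B <= integralRn (fun x => (`|u x| * D x `^ (- s))%:E))%E.
    rewrite /B /integral_on -integralRnZl; last 3 first.
    - exact: (measurable_on hOm_open (mdiv _ s mu)).
    - by rewrite lee_fin powR_ge0.
    - move=> x; apply: (@on_ge0 _ _ Om (fun x => `|u x| / d x `^ s) x) => y.
      exact: (div0 (fun y => `|u y|)).
    apply: le_integralRn.
    - apply: measurable_funeM.
      exact: (measurable_on hOm_open (mdiv _ s mu)).
    - apply/measurable_EFinP; apply: measurable_funM => //.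
      exact: (measurableT_comp (measurable_powR _)).
    - move=> x; rewrite mule_ge0 ?lee_fin ?powR_ge0//.
      apply: (@on_ge0 _ _ Om (fun x => `|u x| / d x `^ s) x) => y.
      exact: (div0 (fun y => `|u y|)).
    move=> x; case: ifPn => [/set_mem Ox|_]; last first.
      by rewrite mule0 lee_fin mulr_ge0 ?powR_ge0.
    rewrite -EFinM lee_fin.
    have [->|ux] := eqVneq (u x) 0; first by rewrite normr0 !mul0r mulr0.
    have Dx0 : 0 < D x := lt_le_trans (d_gt0 x Ox) (dD x).
    have kd0 : 0 < k * d x by rewrite mulr_gt0// d_gt0.
    rewrite mulrCA ler_wpM2l// -powRN -powRM ?(ltW k0) ?(ltW (d_gt0 x Ox))//.
    rewrite !powRN lef_pV2 ?posrE ?powR_gt0//.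
    apply: ge0_ler_powR; rewrite ?nnegrE; [exact: ltW|exact: ltW|exact: ltW|].
    exact/Dkd/uK.
  have high : (integralRn (fun x => (w x)%:E) +
      (k `^ (- s) * Rsup `^ (n%:R - s))%:E * C <= A)%E.
    have c0 : 0 <= k `^ (- s) * Rsup `^ (n%:R - s) by rewrite mulr_ge0 ?powR_ge0.
    have mC := measurable_on hOm_open (mdiv _ (n%:R - 1) mg).
    have C0' x : (0 <= if x \in Om then (grad_norm u x / d x `^ (n%:R - 1))%:E else 0)%E.
      apply: (@on_ge0 _ _ Om (fun x => grad_norm u x / d x `^ (n%:R - 1)) x) => y.
      exact: div0.
    rewrite /A /C /integral_on -integralRnZl// -integralRnD; last 4 first.
    - exact/measurable_EFinP.
    - exact: measurable_funeM.
    - by move=> x; rewrite lee_fin.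
    - by move=> x; rewrite mule_ge0// lee_fin.
    apply: le_integralRn.
    - by apply: emeasurable_funD; [exact/measurable_EFinP|exact: measurable_funeM].
    - exact: (measurable_on hOm_open (mdiv _ (s - 1) mg)).
    - by move=> x; rewrite adde_ge0 ?mule_ge0 ?lee_fin.
    move=> x; case: ifPn => [/set_mem Ox|/negP nOx]; last first.
      rewrite mule0 adde0 lee_fin /w.
      have [->|/gK/KOm/mem_set//] := eqVneq (grad_norm u x) 0.
      by rewrite !mul0r.
    rewrite -EFinM -EFinD lee_fin /w.
    have [->|/gK Kx] := eqVneq (grad_norm u x) 0; first by rewrite !mul0r mulr0 addr0.
    rewrite -mulrA [X in _ + X]mulrCA -mulrDr ler_wpM2l//.
    by apply: hardy_weight_le => //; [exact: d_gt0|exact: Dkd].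
  apply: le_trans high.
  rewrite muleDr ?ge0_adde_def// ?inE ?mule_ge0 ?lee_fin ?powR_ge0// ?(ltW sn0)//.
  rewrite muleA -EFinM addeC leeD2r// muleCA.
  by apply: le_trans hardy; rewrite lee_pmul2l// lte_fin.
rewrite leeBrDr; last by rewrite fin_numM// ge0_fin_numE.
(* The limit [k -> 1] is replaced by a test against all factors [r] in []0, 1[]: each is [k ^ (- s)]
   for [k = r ^ (- s^-1)], which exceeds 1. *)
apply/lee_mul01Pr.
  by rewrite adde_ge0// mule_ge0// lee_fin ?powR_ge0// ltW.
move=> r /andP[r0 r1].
have -> : r = (r `^ (- s^-1)) `^ (- s).
  by rewrite -powRrM mulrNN mulVf ?gt_eqF// powRr1 ?ltW.
apply: key; rewrite powRN invf_gt1 ?powR_gt0//.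
rewrite -[ltRHS](congr1 (@^~ s^-1) (powR1 R)).
by rewrite gt0_ltr_powR ?invr_gt0// nnegrE ltW.
Qed.
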